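(* Let $C,C_1,C_2,\ldots\in\mathcal{C}^3_{\rm c}$. Then: (1) $C_n\xrightarrow{\text{wcc}}C$ implies $(C_n)_{13}\xrightarrow{\text{wcc}}C_{13}$ and $(C_n)_{23}\xrightarrow{\text{wcc}}C_{23}$; (2) $C_n\xrightarrow{\text{wcc}}C$ implies $d_\infty((C_n)_p,C_p)\to0$; (3) $C_n\xrightarrow{\text{wcc}}C$ implies $\psi(C_n)\xrightarrow{\text{wcc}}\psi(C)$.
   Context: $\mathbb{I}=[0,1]$, $\lambda$ Lebesgue measure; $d_\infty$ is the uniform (sup) distance between copulas. Points of $\mathbb{I}^3$ are written $(\mathbf{u},v)$, $\mathbf{u}=(u_1,u_2)$. For a $k$-dimensional copula $A$, $K_A$ is (a version of) the regular conditional distribution of the first $k-1$ coordinates given the last coordinate $=v$; $A_n\xrightarrow{\text{wcc}}A$ (weak conditional convergence) means that for $\lambda$-a.e. $v$ the measures $K_{A_n}(v,\cdot)$ converge weakly to $K_A(v,\cdot)$. For a three-dimensional copula $C$: $C_{13}(u_1,v)=C(u_1,1,v)$, $C_{23}(u_2,v)=C(1,u_2,v)$; $F_{1|3}(u_1|t)=K_C(t,[0,u_1]\times\mathbb{I})$, $F_{2|3}(u_2|t)=K_C(t,\mathbb{I}\times[0,u_2])$. $\mathcal{C}^3_{\rm c}$ is the set of three-dimensional copulas for which $F_{1|3}(\cdot|t)$, $F_{2|3}(\cdot|t)$ are continuous for $\lambda$-a.e. $t$; for such $C$, for a.e. $t$ the conditional copula $C^t_{12;3}$ is the unique bivariate copula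 with $K_C(t,[\mathbf{0},\mathbf{u}])=C^t_{12;3}(F_{1|3}(u_1|t),F_{2|3}(u_2|t))$. The partial copula is $C_p(\mathbf{s})=\int_{\mathbb{I}}C^t_{12;3}(\mathbf{s})\,d\lambda(t)$ and the partial vine copula is $\psi(C)(\mathbf{u},v)=\int_{[0,v]}C_p(F_{1|3}(u_1|t),F_{2|3}(u_2|t))\,d\lambda(t)$. *)

(* Defs.v *)
(* Copulas are represented by their (real-valued)
   functions on [0,1]^k; Markov kernels are MathComp-Analysis probability
   kernels from R (Borel) to R or R*R, supported on the unit interval/square. *)
From HB Require Import structures.
From mathcomp Require Import all_boot all_order all_algebra.
From mathcomp Require Import all_classical all_reals all_analysis.
Import Order.TTheory GRing.Theory Num.Theory numFieldNormedType.Exports.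

Set Implicit Arguments.
Unset Strict Implicit.
Unset Printing Implicit Defensive.

Local Open Scope classical_set_scope.
Local Open Scope ring_scope.

Notation mR R := (measurableTypeR R).
Notation leb R := (@lebesgue_measure R).

(* kernels from I (the conditioning coordinate v) to I^2, resp. I *)
Notation kernel3 R :=
  (probability_kernel (mR R) (mR R * mR R)%type R).
Notation kernel2 R := (probability_kernel (mR R) (mR R) R).

Definition unit_int {R : realType} : set R := `[0%R, 1%R].
Definition unit_sq {R : realType} : set (R * R) := unit_int `*` unit_int.

Definition copula2 {R : realType} (A : R -> R -> R) : Prop :=
  (forall u : R, 0 <= u <= 1 ->
     [/\ A u 0 = 0, A 0 u = 0, A u 1 = u & A 1 u = u]) /\
  (forall a1 b1 a2 b2 : R, 0 <= a1 -> a1 <= b1 -> b1 <= 1 ->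
     0 <= a2 -> a2 <= b2 -> b2 <= 1 ->
     0 <= A b1 b2 - A a1 b2 - A b1 a2 + A a1 a2).

Definition copula3 {R : realType} (C : R -> R -> R -> R) : Prop :=
  (forall a b : R, 0 <= a <= 1 -> 0 <= b <= 1 ->
     [/\ C 0 a b = 0, C a 0 b = 0 & C a b 0 = 0]) /\
  (forall u : R, 0 <= u <= 1 ->
     [/\ C u 1 1 = u, C 1 u 1 = u & C 1 1 u = u]) /\
  (forall a1 b1 a2 b2 a3 b3 : R,
     0 <= a1 -> a1 <= b1 -> b1 <= 1 ->
     0 <= a2 -> a2 <= b2 -> b2 <= 1 ->
     0 <= a3 -> a3 <= b3 -> b3 <= 1 ->
     0 <= C b1 b2 b3 - C a1 b2 b3 - C b1 a2 b3 - C b1 b2 a3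
          + C a1 a2 b3 + C a1 b2 a3 + C b1 a2 a3 - C a1 a2 a3).

Definition is_markov3 {R : realType} (C : R -> R -> R -> R) (K : kernel3 R)
  : Prop :=
  (forall t : R, K t unit_sq = 1%E) /\
  (forall u1 u2 v : R, 0 <= u1 <= 1 -> 0 <= u2 <= 1 -> 0 <= v <= 1 ->
     (C u1 u2 v)%:E =
       (\int[leb R]_(t in `[0%R, v]) K t (`[0%R, u1] `*` `[0%R, u2]))%E).

Definition is_markov2 {R : realType} (A : R -> R -> R) (K : kernel2 R)
  : Prop :=
  (forall t : R, K t unit_int = 1%E) /\
  (forall u v : R, 0 <= u <= 1 -> 0 <= v <= 1 ->
     (A u v)%:E = (\int[leb R]_(t in `[0%R, v]) K t `[0%R, u]%classic)%E).

Definition wconv_sq {R : realType}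
  (mn : nat -> {measure set (mR R * mR R)%type -> \bar R})
  (m : {measure set (mR R * mR R)%type -> \bar R}) : Prop :=
  forall f : (R : topologicalType) * (R : topologicalType) -> R,
    {within unit_sq, continuous f} ->
    (fun n => \int[mn n]_(x in unit_sq) (f x)%:E)%E @ \oo -->
      (\int[m]_(x in unit_sq) (f x)%:E)%E.

Definition wconv_int {R : realType}
  (mn : nat -> {measure set (mR R) -> \bar R})
  (m : {measure set (mR R) -> \bar R}) : Prop :=
  forall f : R -> R, {within unit_int, continuous f} ->
    (fun n => \int[mn n]_(x in unit_int) (f x)%:E)%E @ \oo -->
      (\int[m]_(x in unit_int) (f x)%:E)%E.

(* weak conditional convergence (independent of the chosen versions) *)
Definition wcc3 {R : realType} (Cn : nat -> R -> R -> R -> R)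
  (C : R -> R -> R -> R) : Prop :=
  forall (Kn : nat -> kernel3 R) (K : kernel3 R),
    (forall n, is_markov3 (Cn n) (Kn n)) -> is_markov3 C K ->
    {ae leb R, forall v : R, 0 <= v <= 1 ->
       wconv_sq (fun n => Kn n v) (K v)}.

Definition wcc2 {R : realType} (An : nat -> R -> R -> R)
  (A : R -> R -> R) : Prop :=
  forall (Kn : nat -> kernel2 R) (K : kernel2 R),
    (forall n, is_markov2 (An n) (Kn n)) -> is_markov2 A K ->
    {ae leb R, forall v : R, 0 <= v <= 1 ->
       wconv_int (fun n => Kn n v) (K v)}.

Definition C13 {R : realType} (C : R -> R -> R -> R) : R -> R -> R :=
  fun u1 v => C u1 1 v.
Definition C23 {R : realType} (C : R -> R -> R -> R) : R -> R -> R :=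
  fun u2 v => C 1 u2 v.

Definition F13 {R : realType} (K : kernel3 R) (t u1 : R) : R :=
  fine (K t (`[0%R, u1] `*` unit_int)).
Definition F23 {R : realType} (K : kernel3 R) (t u2 : R) : R :=
  fine (K t (unit_int `*` `[0%R, u2])).

(* continuity of a distribution function of a probability measure on I
   (continuous on I, no atom at 0) *)
Definition cont_df {R : realType} (F : R -> R) : Prop :=
  {within unit_int, continuous F} /\ F 0 = 0.

Definition in_C3c {R : realType} (C : R -> R -> R -> R) : Prop :=
  copula3 C /\
  exists K : kernel3 R, is_markov3 C K /\
    {ae leb R, forall t : R, 0 <= t <= 1 ->
       cont_df (F13 K t) /\ cont_df (F23 K t)}.

Definition cond_copula_family {R : realType} (K : kernel3 R)
  (CC : R -> R -> R -> R) : Prop :=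
  (forall s1 s2 : R, measurable_fun [set: mR R] (fun t => CC t s1 s2)) /\
  {ae leb R, forall t : R, 0 <= t <= 1 ->
     copula2 (CC t) /\
     forall u1 u2 : R, 0 <= u1 <= 1 -> 0 <= u2 <= 1 ->
       K t (`[0%R, u1] `*` `[0%R, u2]) = (CC t (F13 K t u1) (F23 K t u2))%:E}.

Definition partial_copula {R : realType} (CC : R -> R -> R -> R)
  : R -> R -> R :=
  fun s1 s2 => Rintegral (leb R) `[0%R, 1%R] (fun t => CC t s1 s2).

Definition psi {R : realType} (K : kernel3 R) (CC : R -> R -> R -> R)
  : R -> R -> R -> R :=
  fun u1 u2 v => Rintegral (leb R) `[0%R, v]
    (fun t => partial_copula CC (F13 K t u1) (F23 K t u2)).

Definition dinf {R : realType} (A B : R -> R -> R) : \bar R :=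
  ereal_sup [set (`|A x.1 x.2 - B x.1 x.2|)%:E | x in @unit_sq R].

(* Main.v *)
(* Weak convergence on the square to a limit with continuous marginals is equivalent to
   pointwise convergence of the distribution functions: continuous functions are uniform
   limits of step functions on grid boxes, and indicators of boxes are sandwiched between
   continuous ramps. By Lebesgue differentiation, the values of a Markov kernel on the
   countably many grid boxes are determined almost everywhere by the copula, so all three
   claims reduce to convergence of distribution functions for almost every t. For the
   conditional copulas this follows from their uniform Lipschitz continuity, for the
   partial copulas from dominated convergence, and uniformity comes from Lipschitz
   continuity and a finite grid. *)
Require Import Defs.
From HB Require Import structures.
From mathcomp Require Import all_boot all_order all_algebra.
From mathcomp Require Import lra.
From mathcomp Require Import all_classical all_reals all_analysis.
From mathcomp Require Import measurable_realfun.
Import Order.TTheory GRing.Theory Num.Theory numFieldNormedType.Exports.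
Local Open Scope classical_set_scope.
Local Open Scope ring_scope.

Set Implicit Arguments.
Unset Strict Implicit.

(** The obstacle is the order of quantifiers. [wcc2] and [wcc3] range over all versions of the
    kernels, continuity of the conditional margins is granted by [in_C3c] for one version only, and
    each identity between a kernel and a copula holds off a null set that depends on the event. Only
    countably many such null sets can be united, hence the boxes with corners in rational grids. The
    passage from grid boxes to all boxes then goes through weak convergence to the continuous
    version, also when two versions of the same kernel are compared. Continuity of the limiting
    margins enters a second time: it makes them onto the unit interval, so that limits of box
    probabilities determine the limit of the conditional copulas at every argument. *)

Lemma measurable_fun_unif d (T : measurableType d) (R : realType) (D : set T) (f : T -> R) :
  (forall e, 0 < e -> exists2 g : T -> R, measurable_fun D g &
     forall x, D x -> `|f x - g x| <= e) ->
  measurable_fun D f.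
Proof.
move=> approx.
have /choice[g gP] (n : nat) : exists g : T -> R, measurable_fun D g /\
    forall x, D x -> `|f x - g x| <= n.+1%:R^-1.
  by have [|g ? ?] := approx n.+1%:R^-1; [rewrite invr_gt0|exists g].
apply: (measurable_fun_cvg (h := g)) => [n|x Dx]; first by have [] := gP n.
apply/cvgrPdist_le => e e0; near=> n.
apply: (le_trans ((gP n).2 x Dx)).
rewrite ltW//; near: n; exact: (near_infty_natSinv_lt (PosNum e0)).
Unshelve. all: by end_near. Qed.

(** * Integrands whose integrals converge along a sequence of probability measures *)

Section integral_convergence_class.
Context d (T : measurableType d) (R : realType).
Variables (mn : nat -> {measure set T -> \bar R}) (m : {measure set T -> \bar R}).
Variable D : set T.
Hypotheses (mD : measurable D) (mnD : forall n, mn n D = 1%E) (mD1 : m D = 1%E).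

Lemma bounded_integrable (mu : {measure set T -> \bar R}) (f : T -> R) (M : R) :
  mu D = 1%E -> measurable_fun D f -> (forall x, D x -> `|f x| <= M) ->
  mu.-integrable D (EFin \o f).
Proof.
move=> muD mf fM; apply: measurable_bounded_integrable => //.
  by rewrite muD ltry.
exists M; split; first exact: num_real.
by move=> M' MM' x Dx /=; rewrite (le_trans (fM _ Dx))// ltW.
Qed.

(** Measurability and boundedness are bundled with the convergence so that every integral involved
    is finite and the class is closed under linear combinations and uniform limits. *)
Definition integral_cvg (f : T -> R) : Prop :=
  [/\ measurable_fun D f, exists M, forall x, D x -> `|f x| <= M &
      Rintegral (mn n) D f @[n --> \oo] --> Rintegral m D f].

Lemma integral_cvg_eq (f g : T -> R) : (forall x, D x -> f x = g x) ->
  integral_cvg f -> integral_cvg g.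
Proof.
move=> fg [mf [M fM] cf]; split.
- by apply: eq_measurable_fun mf => x /set_mem /fg.
- by exists M => x Dx; rewrite -fg//; exact: fM.
- have E mu : Rintegral mu D g = Rintegral mu D f.
    by apply: eq_Rintegral => x /set_mem Dx; rewrite fg.
  by rewrite E; under eq_fun do rewrite E.
Qed.

Lemma integral_cvgD (f g : T -> R) :
  integral_cvg f -> integral_cvg g -> integral_cvg (fun x => f x + g x).
Proof.
move=> [mf [M fM] cf] [mg [N gN] cg]; split.
- exact: measurable_funD.
- exists (M + N) => x Dx; rewrite (le_trans (ler_normD _ _))//.
  by rewrite lerD ?fM ?gN.
- have E (mu : {measure set T -> \bar R}) : mu D = 1%E ->
      Rintegral mu D (fun x => f x + g x) = Rintegral mu D f + Rintegral mu D g.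
    move=> mu1; apply: RintegralD => //;
      [exact: bounded_integrable fM|exact: bounded_integrable gN].
  rewrite E//; under eq_fun do rewrite E//.
  exact: cvgD.
Qed.

Lemma integral_cvgZ (k : R) (f : T -> R) :
  integral_cvg f -> integral_cvg (fun x => k * f x).
Proof.
move=> [mf [M fM] cf]; split.
- exact: measurable_funM.
- exists (`|k| * M) => x Dx; rewrite normrM ler_wpM2l//; exact: fM.
- have E (mu : {measure set T -> \bar R}) : mu D = 1%E ->
      Rintegral mu D (fun x => k * f x) = k * Rintegral mu D f.
    move=> mu1; apply: RintegralZl => //; exact: bounded_integrable fM.
  rewrite E//; under eq_fun do rewrite E//.
  by apply: cvgM => //; exact: cvg_cst.
Qed.

Lemma integral_cvg_cst (k : R) : integral_cvg (fun=> k).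
Proof.
split.
- exact: measurable_cst.
- by exists `|k|.
- rewrite Rintegral_cst// mD1; under eq_fun do rewrite Rintegral_cst// mnD.
  exact: cvg_cst.
Qed.

Lemma integral_cvg_sum (I : Type) (r : seq I) (f : I -> T -> R) :
  (forall i, integral_cvg (f i)) -> integral_cvg (fun x => \sum_(i <- r) f i x).
Proof.
move=> fi; elim: r => [|i r IH].
  by apply: integral_cvg_eq (integral_cvg_cst 0) => x _; rewrite big_nil.
by apply: integral_cvg_eq (integral_cvgD (fi i) IH) => x _; rewrite big_cons.
Qed.

Lemma integral_cvg_indic (A : set T) : measurable A -> A `<=` D ->
  fine (mn n A) @[n --> \oo] --> fine (m A) -> integral_cvg \1_A.
Proof.
move=> mA AD cA; split.
- exact: measurable_indic.
- by exists 1 => x _; rewrite indicE ger0_norm// lern1 leq_b1.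
- have E (mu : {measure set T -> \bar R}) : Rintegral mu D \1_A = fine (mu A).
    by rewrite /Rintegral integral_indic// setIidl.
  by rewrite E; under eq_fun do rewrite E.
Qed.

Lemma Rintegral_dist (mu : {measure set T -> \bar R}) (f g : T -> R) (e : R) :
  mu D = 1%E -> mu.-integrable D (EFin \o f) -> mu.-integrable D (EFin \o g) ->
  (forall x, D x -> `|f x - g x| <= e) ->
  `|Rintegral mu D f - Rintegral mu D g| <= e.
Proof.
move=> mu1 intf intg fg; rewrite -RintegralB//.
have intB : mu.-integrable D (EFin \o (fun x => f x - g x)).
  rewrite (_ : _ \o _ = (fun x => (f x)%:E - (g x)%:E)%E); last exact/funext.
  exact: integrableB.
apply: (le_trans (le_normr_Rintegral mD intB)).
rewrite [leRHS](_ : e = Rintegral mu D (fun=> e)); last first.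
  by rewrite Rintegral_cst// mu1 /= mulr1.
apply: le_Rintegral => //.
- exact: integrable_norm.
- apply: (bounded_integrable (M := `|e|)) => //; exact: measurable_cst.
Qed.

(** All the measures have mass 1 on [D], so replacing [f] by an approximant changes each integral by
    at most e / 3, uniformly in n; the last third is the convergence for the approximant. *)
Lemma integral_cvg_unif (f : T -> R) :
  (forall e, 0 < e -> exists2 g, integral_cvg g & forall x, D x -> `|f x - g x| <= e) ->
  integral_cvg f.
Proof.
move=> approx.
have mf : measurable_fun D f.
  apply: measurable_fun_unif => e /approx[g [mg _ _] fg].
  by exists g.
have bf : exists M, forall x, D x -> `|f x| <= M.
  have [g [_ [M gM] _] fg] := approx _ ltr01; exists (1 + M) => x Dx.
  rewrite -(subrK (g x) (f x)) (le_trans (ler_normD _ _))//.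
  by rewrite lerD ?fg ?gM.
split => //; apply/cvgrPdist_le => e e0.
have e3 : 0 < e / 3 by rewrite divr_gt0.
have [g [mg [N gN] cg] fg] := approx _ e3.
have [M fM] := bf.
have E (mu : {measure set T -> \bar R}) : mu D = 1%E ->
    `|Rintegral mu D f - Rintegral mu D g| <= e / 3.
  by move=> mu1; apply: Rintegral_dist => //;
    [exact: bounded_integrable fM|exact: bounded_integrable gN].
move/cvgrPdist_le : cg => /(_ _ e3) cg.
near=> n.
have h1 := E m mD1; have h2 := E (mn n) (mnD n).
have h3 : `|Rintegral m D g - Rintegral (mn n) D g| <= e / 3.
  by near: n; exact: cg.
rewrite distrC in h2.
have -> : Rintegral m D f - Rintegral (mn n) D f =
  (Rintegral m D f - Rintegral m D g) +
  ((Rintegral m D g - Rintegral (mn n) D g) +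
  (Rintegral (mn n) D g - Rintegral (mn n) D f)).
  by lra.
rewrite (le_trans (ler_normD _ _))// (le_trans (lerD h1 (ler_normD _ _)))//.
rewrite (le_trans (lerD (lexx _) (lerD h3 h2)))//; lra.
Unshelve. all: by end_near. Qed.

Lemma integral_cvg_ereal (f : T -> R) : integral_cvg f ->
  (\int[mn n]_(x in D) (f x)%:E)%E @[n --> \oo] --> (\int[m]_(x in D) (f x)%:E)%E.
Proof.
move=> [mf [M fM] cf].
have E (mu : {measure set T -> \bar R}) : mu D = 1%E ->
    (\int[mu]_(x in D) (f x)%:E)%E = (Rintegral mu D f)%:E.
  move=> mu1; rewrite /Rintegral fineK//; apply: integrable_fin_num => //.
  exact: bounded_integrable fM.
rewrite E//; under eq_fun do rewrite E//.
by apply: cvg_EFin; [exact: nearW|exact: cf].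
Qed.

End integral_convergence_class.

(** * Uniform approximation by step functions on a grid *)

Section step_functions.
Context {R : realType}.

(** Heine-Cantor through the near-covering form of compactness: a radius that works at x still
    works, once halved, at all points of [A] close to x, and compactness then yields one radius for
    the whole of [A]. *)
Lemma compact_unif_continuous (T : pseudoMetricType R) (A : set T) (f : T -> R) :
  compact A -> {within A, continuous f} ->
  forall e, 0 < e -> exists2 d, 0 < d &
    forall x y, A x -> A y -> ball x d y -> `|f x - f y| <= e.
Proof.
move=> /compact_near_coveringP cA cf e e0.
have e2 : 0 < e / 2 by rewrite divr_gt0.
pose P (d : R) (x : T) := A x -> forall y, A y -> ball x d y -> `|f x - f y| <= e.
have : \forall d \near 0^'+, A `<=` P d.
  apply: (cA R 0^'+ P) => x Ax.
  have /subspace_continuousP/(_ x Ax)/cvgrPdist_le/(_ _ e2) := cf.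
  move=> /nbhs_ballP[d /= d0 xd].
  have d2 : 0 < d / 2 by rewrite divr_gt0.
  exists (ball x (d / 2), [set r | r < d / 2]); first split => /=.
  - exact: nbhsx_ballx.
  - exact: nbhs_right_lt.
  move=> [x' r] /= [xx' rd] Ax' y Ay x'y.
  have xy : ball x d y.
    by rewrite [d]splitr; apply: ball_triangle xx' (le_ball (ltW rd) x'y).
  have {}xx' : ball x d x'.
    by apply: le_ball xx'; rewrite ler_pdivrMr// ler_peMr// ?ltW// ltr1n.
  have {}xd t : ball x d t -> A t -> `|f x - f t| <= e / 2 by exact: xd.
  have := xd _ xx' Ax'; have := xd _ xy Ay.
  by rewrite !ler_distl => /andP[? ?] /andP[? ?]; apply/andP; split; lra.
move=> dP.
have [d [d0 Ad]] : exists d, 0 < d /\ A `<=` P d.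
  near (0 : R)^'+ => d; exists d; split; near: d; last exact: dP.
  exact: nbhs_right_gt.
by exists d => // x y Ax Ay xy; exact: (Ad x Ax Ax).
Unshelve. all: by end_near. Qed.

Definition grid (N i : nat) : R := i%:R / N.+1%:R.

(* Empty for i = 0, so that the consecutive differences partition [0, 1]. *)
Definition grid_itv (N i : nat) : set R :=
  if i is 0 then set0 else `[0, grid N i]%classic.

(** The indicator of a grid cell, open at its left end except for the first cell. The difference
    form reduces its integral to masses of intervals starting at 0, which are the ones whose
    convergence is available. *)
Definition grid_wgt (N i : nat) (x : R) : R :=
  \1_(grid_itv N i.+1) x - \1_(grid_itv N i) x.

Lemma grid_ge0 N i : 0 <= grid N i.
Proof. by rewrite divr_ge0. Qed.

Lemma grid_le1 N i : (i <= N.+1)%N -> grid N i <= 1.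
Proof. by move=> iN; rewrite ler_pdivrMr// mul1r ler_nat. Qed.

Lemma gridS N i : grid N i.+1 = grid N i + N.+1%:R^-1.
Proof. by rewrite /grid -natr1 mulrDl mul1r. Qed.

Lemma grid_itv_sub N i : grid_itv N i `<=` grid_itv N i.+1.
Proof.
case: i => [//|i] x /=; rewrite !in_itv/= => /andP[-> /le_trans]; apply.
by rewrite [leRHS]gridS lerDl invr_ge0.
Qed.

Lemma grid_wgt_ge0 N i x : 0 <= grid_wgt N i x.
Proof.
rewrite subr_ge0 !indicE ler_nat.
have [/set_mem/grid_itv_sub/mem_set ->//|//] := boolP (x \in grid_itv N i).
Qed.

Lemma grid_wgt_neq0 N i x : grid_wgt N i x != 0 ->
  `|grid N i.+1 - x| <= N.+1%:R^-1.
Proof.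
rewrite /grid_wgt !indicE.
have [/set_mem xi1|xi1] := boolP (x \in grid_itv N i.+1); last first.
  have [/set_mem/grid_itv_sub/mem_set|_] := boolP (x \in grid_itv N i).
    by rewrite (negbTE xi1).
  by rewrite subrr eqxx.
have [_|xi _] := boolP (x \in grid_itv N i); first by rewrite subrr eqxx.
move: xi1; rewrite /= in_itv/= => /andP[x0 xi1].
rewrite ger0_norm ?subr_ge0// lerBlDl gridS.
(* What remains is [grid N i <= x]. For i = 0 the removed interval is empty and says nothing, but
   [grid N 0] is 0; otherwise x lies outside that interval, hence to its right. *)
rewrite lerD2r; case: i xi {xi1} => [|i] xi; first by rewrite /grid mul0r.
by rewrite leNgt; apply: contra xi => xi; rewrite inE /= in_itv/= x0 ltW.
Qed.

Lemma sum_grid_wgt N x : 0 <= x <= 1 -> \sum_(i < N.+1) grid_wgt N i x = 1.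
Proof.
move=> x01; rewrite -(big_mkord xpredT (fun i => grid_wgt N i x)).
rewrite /grid_wgt telescope_sumr// /grid_itv !indicE in_set0 subr0.
by rewrite mem_set//= in_itv/= /grid divff.
Qed.

Definition step_fun1 (N : nat) (f : R -> R) (x : R) : R :=
  \sum_(i < N.+1) f (grid N i.+1) * grid_wgt N i x.

Definition step_fun2 (N : nat) (f : R * R -> R) (x : R * R) : R :=
  \sum_(i < N.+1) \sum_(j < N.+1)
    f (grid N i.+1, grid N j.+1) * (grid_wgt N i x.1 * grid_wgt N j x.2).

(** Because the weights sum to 1, the difference is itself a weighted average of the [c - g i], and
    indices of zero weight drop out of it. *)
Lemma weighted_sum_dist (I : finType) (w g : I -> R) (c e : R) :
  (forall i, 0 <= w i) -> \sum_i w i = 1 ->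
  (forall i, w i != 0 -> `|c - g i| <= e) -> `|c - \sum_i g i * w i| <= e.
Proof.
move=> w0 w1 h.
have -> : c - \sum_i g i * w i = \sum_i (c - g i) * w i.
  by under [RHS]eq_bigr do rewrite mulrBl; rewrite sumrB -mulr_sumr w1 mulr1.
rewrite (le_trans (ler_norm_sum _ _ _))//.
rewrite -[leRHS]mulr1 -w1 mulr_sumr; apply: ler_sum => i _.
rewrite normrM (ger0_norm (w0 i)).
have [->|wi] := eqVneq (w i) 0; first by rewrite !mulr0.
by rewrite ler_wpM2r// h.
Qed.

Lemma grid_in01 N (i : 'I_N.+1) : 0 <= grid N i.+1 <= 1.
Proof. by rewrite grid_ge0 grid_le1// ltn_ord. Qed.

Lemma unit_intP (x : R) : unit_int x <-> 0 <= x <= 1.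
Proof. by rewrite /unit_int /= in_itv. Qed.

Lemma invS_lt (d : R) : 0 < d -> exists N : nat, N.+1%:R^-1 < d.
Proof.
move=> d0; near \oo => N; exists N.
near: N; exact: (near_infty_natSinv_lt (PosNum d0)).
Unshelve. all: by end_near. Qed.

Lemma step_fun1_approx (f : R -> R) (e : R) :
  {within unit_int, continuous f} -> 0 < e ->
  exists N, forall x, unit_int x -> `|f x - step_fun1 N f x| <= e.
Proof.
move=> cf e0.
have [d d0 fd] := compact_unif_continuous (segment_compact (a := 0) (b := 1)) cf e0.
have [N Nd] := invS_lt d0; exists N => x x01.
apply: weighted_sum_dist => [i||i wi].
- exact: grid_wgt_ge0.
- by apply: sum_grid_wgt; apply/unit_intP.
- apply: fd => //; first by apply/unit_intP/grid_in01.
  by rewrite /ball/= distrC (le_lt_trans (grid_wgt_neq0 wi)).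
Qed.

Lemma step_fun2_approx (f : (R : topologicalType) * (R : topologicalType) -> R) (e : R) :
  {within unit_sq, continuous f} -> 0 < e ->
  exists N, forall x, unit_sq x -> `|f x - step_fun2 N f x| <= e.
Proof.
move=> cf e0.
have csq : compact (@unit_sq R) by apply: compact_setX; exact: segment_compact.
have [d d0 fd] := @compact_unif_continuous (R * R)%type _ _ csq cf _ e0.
have [N Nd] := invS_lt d0; exists N => -[x y] xy.
have [/unit_intP x01 /unit_intP y01] : unit_int x /\ unit_int y by [].
(* Flattened to one sum over pairs, the product weights are again nonnegative with sum 1. *)
rewrite /step_fun2 pair_bigA/=.
apply: weighted_sum_dist => [i||[i j]/=].
- by rewrite mulr_ge0 ?grid_wgt_ge0.
- rewrite -(pair_bigA _ (fun i j : 'I_N.+1 => grid_wgt N i x * grid_wgt N j y))/=.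
  under eq_bigr do rewrite -mulr_sumr sum_grid_wgt// mulr1.
  exact: sum_grid_wgt.
- rewrite mulf_eq0 negb_or => /andP[wi wj].
  apply: fd; [by []|by split; apply/unit_intP/grid_in01|].
  split; rewrite /ball/= distrC.
  - exact: le_lt_trans (grid_wgt_neq0 wi) Nd.
  - exact: le_lt_trans (grid_wgt_neq0 wj) Nd.
Qed.

End step_functions.

(** * From masses of grid boxes to weak convergence *)

Section weak_convergence_from_grid.
Context {R : realType}.

Lemma measurable_grid_itv N i : measurable (@grid_itv R N i).
Proof. by case: i => [|i]; [exact: measurable0|exact: measurable_itv]. Qed.

Lemma grid_itv_unit N i : (i <= N.+1)%N -> @grid_itv R N i `<=` unit_int.
Proof.
case: i => [_ x []|i iN x]; rewrite /grid_itv /= in_itv/= => /andP[x0 xi].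
by apply/unit_intP; rewrite x0 (le_trans xi)// grid_le1.
Qed.

Lemma measurable_unit_int : measurable (@unit_int R : set (mR R)).
Proof. exact: measurable_itv. Qed.

Lemma measurable_unit_sq : measurable (@unit_sq R : set (mR R * mR R)).
Proof. by apply: measurableX; exact: measurable_unit_int. Qed.

Lemma wconv_int_grid (mn : nat -> {measure set (mR R) -> \bar R})
    (m : {measure set (mR R) -> \bar R}) :
  (forall n, mn n unit_int = 1%E) -> m unit_int = 1%E ->
  (forall N i, (i <= N.+1)%N ->
     fine (mn n `[0, grid N i]%classic) @[n --> \oo] -->
     fine (m `[0, grid N i]%classic)) ->
  wconv_int mn m.
Proof.
move=> mn1 m1 cG f cf.
apply: integral_cvg_ereal => //; first exact: measurable_unit_int.
apply: integral_cvg_unif => // [|e e0]; first exact: measurable_unit_int.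
have [N fN] := step_fun1_approx cf e0.
exists (step_fun1 N f) => //.
apply: (@integral_cvg_sum _ (mR R)) => // [|i]; first exact: measurable_unit_int.
apply: integral_cvgZ => //; first exact: measurable_unit_int.
have gi j : (j <= N.+1)%N -> integral_cvg mn m unit_int \1_(@grid_itv R N j).
  move=> jN; apply: integral_cvg_indic.
  - exact: measurable_unit_int.
  - exact: measurable_grid_itv.
  - exact: grid_itv_unit.
  - case: j jN => [_|j jN]; last exact: cG.
    by rewrite measure0; under eq_fun do rewrite measure0; exact: cvg_cst.
have iN := ltn_ord i.
apply: (@integral_cvg_eq _ (mR R) _ _ _ _ (fun x =>
    \1_(grid_itv N i.+1) x + (-1) * \1_(grid_itv N i) x)).
  by move=> x _; rewrite mulN1r.
apply: integral_cvgD => //; [exact: measurable_unit_int|exact: gi|].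
apply: integral_cvgZ => //; first exact: measurable_unit_int.
by apply: gi; exact: ltnW.
Qed.

Lemma wconv_sq_grid (mn : nat -> {measure set (mR R * mR R)%type -> \bar R})
    (m : {measure set (mR R * mR R)%type -> \bar R}) :
  (forall n, mn n unit_sq = 1%E) -> m unit_sq = 1%E ->
  (forall N i j, (i <= N.+1)%N -> (j <= N.+1)%N ->
     fine (mn n (`[0, grid N i]%classic `*` `[0, grid N j]%classic)) @[n --> \oo] -->
     fine (m (`[0, grid N i]%classic `*` `[0, grid N j]%classic))) ->
  wconv_sq mn m.
Proof.
move=> mn1 m1 cG f cf.
have msq := measurable_unit_sq.
apply: integral_cvg_ereal => //.
apply: integral_cvg_unif => // e e0.
have [N fN] := step_fun2_approx cf e0.
exists (step_fun2 N f) => //.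
apply: (@integral_cvg_sum _ (mR R * mR R)%type) => // i.
apply: (@integral_cvg_sum _ (mR R * mR R)%type) => // j.
apply: integral_cvgZ => //.
pose ind k l : R * R -> R := \1_(@grid_itv R N k `*` @grid_itv R N l).
have gi k l : (k <= N.+1)%N -> (l <= N.+1)%N -> integral_cvg mn m unit_sq (ind k l).
  move=> kN lN; apply: integral_cvg_indic => //.
  - by apply: measurableX; exact: measurable_grid_itv.
  - by move=> [x y] [/= xk yl]; split; [exact: grid_itv_unit xk|exact: grid_itv_unit yl].
  - case: k l kN lN => [|k] [|l] kN lN; last exact: cG.
    + by rewrite set0X measure0; under eq_fun do rewrite measure0; exact: cvg_cst.
    + by rewrite set0X measure0; under eq_fun do rewrite measure0; exact: cvg_cst.
    + by rewrite setX0 measure0; under eq_fun do rewrite measure0; exact: cvg_cst.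
have iN := ltn_ord i; have jN := ltn_ord j.
(* Inclusion-exclusion: the product of two differences of indicators expands into four boxes
   anchored at the origin. *)
apply: (@integral_cvg_eq _ (mR R * mR R)%type _ _ _ _ (fun x =>
    (ind i.+1 j.+1 x + (-1) * ind i j.+1 x) +
    ((-1) * ind i.+1 j x + ind i j x))).
  have E k l (x : R * R) : ind k l x = \1_(grid_itv N k) x.1 * \1_(grid_itv N l) x.2.
    by rewrite /ind !indicE in_setX -natrM mulnb.
  by move=> x _; rewrite !E /grid_wgt; lra.
by repeat (apply: integral_cvgD => //; try apply: integral_cvgZ => //);
  apply: gi => //; exact: ltnW.
Qed.

End weak_convergence_from_grid.

(** * Densities determined almost everywhere by their primitives *)

Section ae_uniqueness.
Context {R : realType}.

Lemma bounded_integrable_itv (f : R -> R) (M a b : R) :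
  measurable_fun [set: mR R] f -> (forall x, `|f x| <= M) ->
  (leb R).-integrable `[a, b] (EFin \o f).
Proof.
move=> mf fM; apply: measurable_bounded_integrable => //.
- exact/compact_finite_measure/segment_compact.
- exact: measurable_funTS.
- exists M; split; first exact: num_real.
  by move=> M' MM' x _ /=; rewrite (le_trans (fM _))// ltW.
Qed.

Lemma bounded_locally_integrable (f : R -> R) (M : R) :
  measurable_fun [set: mR R] f -> (forall x, `|f x| <= M) ->
  locally_integrable [set: R] f.
Proof.
move=> mf fM; split => //; first exact: openT.
move=> K _ cK; have mK := compact_measurable cK.
have /integrableP[] // : (leb R).-integrable K (EFin \o f).
apply: measurable_bounded_integrable => //.
- exact/compact_finite_measure.
- exact: measurable_funTS.
- exists M; split; first exact: num_real.
  by move=> M' MM' x _ /=; rewrite (le_trans (fM _))// ltW.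
Qed.

Lemma ae_neq (a : R) : {ae leb R, forall t : R, t != a}.
Proof.
exists [set a]; split => //; first exact: lebesgue_measure_set1.
by move=> t /= /negP; rewrite negbK => /eqP.
Qed.

(* Both functions are almost everywhere the derivative of their common primitive. *)
Lemma ae_eq_of_integral (f g : R -> R) (M N : R) :
  measurable_fun [set: mR R] f -> (forall x, `|f x| <= M) ->
  measurable_fun [set: mR R] g -> (forall x, `|g x| <= N) ->
  (forall v, 0 <= v <= 1 ->
     Rintegral (leb R) `[0, v] f = Rintegral (leb R) `[0, v] g) ->
  {ae leb R, forall t : R, 0 <= t <= 1 -> f t = g t}.
Proof.
move=> mf fM mg gN fg.
have mh : measurable_fun [set: mR R] (f \- g) by exact: measurable_funB.
have hMN x : `|(f \- g) x| <= M + N.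
  by rewrite (le_trans (ler_normB _ _))// lerD.
have := FTC1 (a := BLeft 0) (fun y => bounded_integrable_itv 0 y mh hMN)
  (bounded_locally_integrable mh hMN).
(* The two endpoints form a null set; away from them the unit interval is a neighbourhood of t, so
   the primitive of f - g vanishes near t and so does its derivative. *)
apply: (@filterS3 _ _ (ae_filter_ringOfSetsType _) _ _ _ _ _ (ae_neq 0) (ae_neq 1)).
move=> t t0 t1 ftc /andP[t0' t1'].
have {}t0 : 0 < t by rewrite lt_neqAle eq_sym t0.
have {}t1 : t < 1 by rewrite lt_neqAle t1.
have [|_] := ftc; first by rewrite lte_fin.
rewrite derive1E (@near_eq_derive _ _ _ _ (cst 0)); last first.
  near=> y.
  have y01 : 0 <= y <= 1.
    apply/andP; split; apply: ltW; near: y; [exact: lt_nbhsr|exact: lt_nbhsl].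
  rewrite RintegralB//; first by rewrite fg// subrr.
  - exact: bounded_integrable_itv fM.
  - exact: bounded_integrable_itv gN.
by rewrite derive_cst => /esym/eqP; rewrite /= subr_eq0 => /eqP.
Unshelve. all: by end_near. Qed.

End ae_uniqueness.

(** * Probability measures carried by a set *)

Section supported_probability.
Context d (T : measurableType d) (R : realType).
Variables (mu : {measure set T -> \bar R}) (D : set T).
Hypotheses (mD : measurable D) (muT : mu setT = 1%E) (muD : mu D = 1%E).

Lemma probability_fin_num A : measurable A -> mu A \is a fin_num.
Proof.
move=> mA; rewrite ge0_fin_numE//; apply: (@le_lt_trans _ _ 1%E); last exact: ltry.
by rewrite -muT le_measure ?inE.
Qed.

(** The complement of [D] is null, so an inclusion has to hold only inside [D]. This lets boxes that
    stick out of the unit square be compared. *)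
Lemma supported_le A B : measurable A -> measurable B -> A `&` D `<=` B ->
  fine (mu A) <= fine (mu B).
Proof.
move=> mA mB AB.
have muDC : mu (~` D) = 0%E.
  have mDC : measurable (~` D) by exact: measurableC.
  have : mu setT = (mu (~` D) + mu D)%E.
    by rewrite (measureDI mu measurableT mD) setTD setTI.
  rewrite muT muD.
  have /fineK <- := probability_fin_num mDC.
  by rewrite -EFinD => -[] h; congr EFin; lra.
have -> : mu A = mu (A `&` D).
  rewrite (measureDI mu mA mD) [X in (X + _)%E](_ : _ = 0%E) ?add0e//.
  apply/eqP; rewrite -measure_le0 -muDC le_measure ?inE//.
  - exact: measurableD.
  - exact: measurableC.
rewrite fine_le ?probability_fin_num//; first exact: measurableI.
by rewrite le_measure ?inE//; exact: measurableI.
Qed.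

Lemma fine_probability_le1 A : measurable A -> 0 <= fine (mu A) <= 1.
Proof.
move=> mA; rewrite fine_ge0//=.
rewrite [leRHS](_ : 1 = fine (mu setT)); last by rewrite muT.
by apply: supported_le.
Qed.

Lemma fine_probabilityD A B : measurable A -> measurable B -> B `<=` A ->
  fine (mu (A `\` B)) = fine (mu A) - fine (mu B).
Proof.
move=> mA mB BA; rewrite measureD//.
  by rewrite setIidr// fineB// probability_fin_num.
by rewrite -ge0_fin_numE// probability_fin_num.
Qed.

End supported_probability.

(** * Continuous piecewise linear cutoffs *)

Section ramp.
Context {R : realType}.

Definition ramp (a e x : R) : R := Num.min 1 (Num.max 0 ((a + e - x) / e)).

Lemma ramp_ge0 a e x : 0 <= ramp a e x.
Proof. by rewrite /ramp le_min ler01 le_max lexx. Qed.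

Lemma ramp_le1 a e x : ramp a e x <= 1.
Proof. by rewrite /ramp ge_min lexx. Qed.

Lemma ramp_eq1 a e x : 0 < e -> x <= a -> ramp a e x = 1.
Proof.
move=> e0 xa; rewrite /ramp min_l// le_max ler_pdivlMr// mul1r; apply/orP; right; lra.
Qed.

Lemma ramp_eq0 a e x : 0 < e -> a + e <= x -> ramp a e x = 0.
Proof.
move=> e0 ax; rewrite /ramp max_l ?min_r//.
by rewrite ler_pdivrMr// mul0r; lra.
Qed.

Lemma continuous_ramp a e : continuous (ramp a e).
Proof.
move=> x; apply: (@continuous_min R R (cst 1) (fun x => Num.max 0 ((a + e - x) / e))).
  exact: cvg_cst.
apply: (@continuous_max R R (cst 0) (fun x => (a + e - x) / e)); first exact: cvg_cst.
apply: cvgM; last exact: cvg_cst.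
by apply: cvgB; [exact: cvg_cst|exact: cvg_id].
Qed.

Definition ramp2 (a b e : R) (x : R * R) : R := ramp a e x.1 * ramp b e x.2.

Lemma continuous_ramp2 a b e :
  continuous (ramp2 a b e : (R : topologicalType) * (R : topologicalType) -> R).
Proof.
move=> x; apply: cvgM.
- apply: (@continuous_comp _ _ _ fst (ramp a e)); first exact: cvg_fst.
  exact: continuous_ramp.
- apply: (@continuous_comp _ _ _ snd (ramp b e)); first exact: cvg_snd.
  exact: continuous_ramp.
Qed.

End ramp.

(** * From weak convergence to masses of boxes *)

Section box_convergence.
Context {R : realType}.

Definition box (a b : R) : set (mR R * mR R) := `[0, a]%classic `*` `[0, b]%classic.

Lemma measurable_box a b : measurable (box a b).
Proof. by apply: measurableX; exact: measurable_itv. Qed.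

Lemma indic_box a b (x : R * R) : unit_sq x ->
  \1_(box a b) x = ((x.1 <= a) && (x.2 <= b))%:R :> R.
Proof.
case: x => x y [/= /unit_intP/andP[x0 _] /unit_intP/andP[y0 _]].
rewrite indicE; congr (nat_of_bool _)%:R.
apply/idP/idP => [/set_mem[/=]|]; first by rewrite !in_itv/= => /andP[_ ->] /andP[_ ->].
by move=> /andP[xa yb]; apply/mem_set; split; rewrite /= in_itv/= ?x0 ?y0.
Qed.

Lemma indic_box_ramp2 a b e x : 0 < e -> unit_sq x ->
  \1_(box a b) (x : R * R) <= ramp2 a b e x <= \1_(box (a + e) (b + e)) x.
Proof.
move=> e0 xD; rewrite !indic_box// /ramp2.
have r01 c y : 0 <= ramp c e y <= 1 by rewrite ramp_ge0 ramp_le1.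
apply/andP; split.
  have [xa|_] := leP x.1 a; last by rewrite /= mulr_ge0// ramp_ge0.
  have [xb|_] := leP x.2 b; last by rewrite /= mulr_ge0// ramp_ge0.
  by rewrite !ramp_eq1// mul1r.
have [xa|xa] := leP x.1 (a + e); last by rewrite ramp_eq0 ?mul0r// ltW.
have [xb|xb] := leP x.2 (b + e); last by rewrite (@ramp_eq0 _ b) ?mulr0// ltW.
by rewrite /= mulr_ile1// ?ramp_ge0 ?ramp_le1.
Qed.

Section one_measure.
Variable mu : {measure set (mR R * mR R)%type -> \bar R}.
Hypotheses (muT : mu setT = 1%E) (mu1 : mu unit_sq = 1%E).

Let msq := @measurable_unit_sq R.

Lemma Rintegral_indic_box a b :
  Rintegral mu unit_sq \1_(box a b) = fine (mu (box a b)).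
Proof.
rewrite /Rintegral integral_indic//; last exact: measurable_box.
have mB := measurable_box a b.
have mBI : measurable (box a b `&` unit_sq) by exact: measurableI.
apply/eqP; rewrite eq_le; apply/andP; split.
- by apply: (supported_le msq muT mu1) => [//|//|x [[]]].
- by apply: (supported_le msq muT mu1).
Qed.

Lemma integrable_ramp2 a b e : mu.-integrable unit_sq (EFin \o ramp2 a b e).
Proof.
apply: (@bounded_integrable _ _ _ _ _ _ _ 1) => //.
  have mr c : measurable_fun [set: R] (ramp c e).
    by apply: continuous_measurable_fun; exact: continuous_ramp.
  apply: (@measurable_funM _ _ _ _ (ramp a e \o fst) (ramp b e \o snd)).
    by apply: measurableT_comp (mr a) _; exact: measurable_funTS measurable_fst.
  by apply: measurableT_comp (mr b) _; exact: measurable_funTS measurable_snd.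
move=> x _; rewrite ger0_norm ?mulr_ge0 ?ramp_ge0//.
by rewrite mulr_ile1// ?ramp_ge0 ?ramp_le1.
Qed.

Lemma box_ramp_le a b e : 0 < e ->
  fine (mu (box a b)) <= Rintegral mu unit_sq (ramp2 a b e)
    <= fine (mu (box (a + e) (b + e))).
Proof.
move=> e0; rewrite -!Rintegral_indic_box.
have iB c c' : mu.-integrable unit_sq (EFin \o \1_(box c c')).
  apply: (@bounded_integrable _ _ _ _ _ _ _ 1) => //.
    by apply: measurable_indic; exact: measurable_box.
  by move=> x _; rewrite indicE ger0_norm// lern1 leq_b1.
have iR := integrable_ramp2 a b e.
apply/andP; split.
- apply: le_Rintegral; [by []|exact: iB|exact: iR|].
  by move=> x /(indic_box_ramp2 a b e0)/andP[].
- apply: le_Rintegral; [by []|exact: iR|exact: iB|].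
  by move=> x /(indic_box_ramp2 a b e0)/andP[].
Qed.

(** For [mu] equal to [K t] these are convertible with [F13 K t] and [F23 K t], which lets
    continuity of the conditional margins be used here as it stands. *)
Definition cdf1 (a : R) : R := fine (mu (box a 1)).
Definition cdf2 (b : R) : R := fine (mu (box 1 b)).

Lemma fine_box_le a b a' b' : a <= a' -> b <= b' ->
  fine (mu (box a b)) <= fine (mu (box a' b')).
Proof.
move=> aa' bb'; apply: (supported_le msq muT mu1) => //.
- exact: measurable_box.
- exact: measurable_box.
- move=> [x y] [[/=]]; rewrite !in_itv/= => /andP[x0 xa] /andP[y0 yb] _.
  by split; rewrite /= in_itv/= ?x0 ?y0/= (le_trans _ aa', le_trans _ bb').
Qed.

(** Inside the square, the part gained by widening the box lies in the strip between a and a', and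
    the mass of that strip is an increment of the first margin. Thus moduli of continuity of the
    margins control those of the joint distribution function. *)
Lemma fine_box_subl a a' b : a <= a' ->
  fine (mu (box a' b)) - fine (mu (box a b)) <= cdf1 a' - cdf1 a.
Proof.
move=> aa'.
have sub c : box a c `<=` box a' c.
  by move=> x []; rewrite /= !in_itv/= => /andP[x0 xa] xb; split => //=;
    rewrite in_itv/= x0 (le_trans xa).
rewrite /cdf1 -!(fine_probabilityD muT)//; try exact: measurable_box.
apply: (supported_le msq muT mu1) => //.
- by apply: measurableD; exact: measurable_box.
- by apply: measurableD; exact: measurable_box.
- move=> x [[[xa' xb] nab] [_ x2]]; split; first by split.
  by move=> [xa _]; apply: nab; split.
Qed.

Lemma fine_box_subr a b b' : b <= b' ->
  fine (mu (box a b')) - fine (mu (box a b)) <= cdf2 b' - cdf2 b.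
Proof.
move=> bb'.
have sub c : box c b `<=` box c b'.
  by move=> x []; rewrite /= !in_itv/= => xa /andP[x0 xb]; split => //=;
    rewrite in_itv/= x0 (le_trans xb).
rewrite /cdf2 -!(fine_probabilityD muT)//; try exact: measurable_box.
apply: (supported_le msq muT mu1) => //.
- by apply: measurableD; exact: measurable_box.
- by apply: measurableD; exact: measurable_box.
- move=> x [[[xa xb'] nab] [x1 _]]; split; first by split.
  by move=> [_ xb]; apply: nab; split.
Qed.

Lemma cdf1_lt0 a : a < 0 -> cdf1 a = 0.
Proof.
by move=> a0; rewrite /cdf1 /box set_itv_ge ?set0X ?measure0// bnd_simp -ltNge.
Qed.

Lemma cdf2_lt0 a : a < 0 -> cdf2 a = 0.
Proof.
by move=> a0; rewrite /cdf2 /box [X in _ `*` X]set_itv_ge ?setX0 ?measure0// bnd_simp -ltNge.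
Qed.

Lemma fine_box_ge1 a b : 1 <= a -> 1 <= b -> fine (mu (box a b)) = 1.
Proof.
move=> a1 b1; apply/eqP; rewrite eq_le.
have [/andP[_ ->]] := fine_probability_le1 msq muT mu1 (measurable_box a b).
rewrite [leLHS](_ : 1 = fine (mu (box 1 1))) ?fine_box_le//.
by rewrite -[box 1 1]/unit_sq mu1.
Qed.

End one_measure.

(** Continuity is known only within the unit interval, while a - r and a + r may leave it. At the
    ends [F 0 = 0] and [F 1 = 1] agree with the constant values outside, so an overshooting point
    may be replaced by the nearest end. *)
Lemma cont_df_modulus (F : R -> R) (a e : R) :
  cont_df F -> {homo F : x y / x <= y} -> (forall x, x < 0 -> F x = 0) ->
  (forall x, 1 <= x -> F x = 1) -> 0 <= a <= 1 -> 0 < e ->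
  exists2 r, 0 < r & F (a + r) - F (a - r) <= e.
Proof.
move=> [cF F0] mF Fneg F1 a01 e0.
have e2 : 0 < e / 2 by rewrite divr_gt0.
have Ia : unit_int a by exact/unit_intP.
have /subspace_continuousP/(_ _ Ia)/cvgrPdist_le/(_ _ e2) := cF.
move=> /nbhs_ballP[r /= r0 ar]; exists (r / 2); first by rewrite divr_gt0.
have {}ar y : 0 <= y -> y <= 1 -> a - r < y -> y < a + r ->
    F y - e / 2 <= F a <= F y + e / 2.
  move=> y0 y1 ay ya; rewrite -ler_distl; apply: ar.
    by rewrite /ball/= ltr_distl; apply/andP; split; lra.
  by apply/unit_intP; rewrite y0.
have r2 : 0 < r / 2 by rewrite divr_gt0.
move/andP: a01 => [a0 a1].
have h1 : F (a + r / 2) <= F a + e / 2.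
  have [ar1|ar1] := leP (a + r / 2) 1.
    have /andP[] : F (a + r / 2) - e / 2 <= F a <= F (a + r / 2) + e / 2.
      by apply: ar; lra.
    lra.
  have E1 : F 1 = 1 by exact: F1.
  have -> : F (a + r / 2) = 1 by apply: F1; lra.
  have /andP[] : F 1 - e / 2 <= F a <= F 1 + e / 2 by apply: ar => //; lra.
  rewrite E1; lra.
have h2 : F a - e / 2 <= F (a - r / 2).
  have [ar1|ar1] := leP 0 (a - r / 2).
    have /andP[] : F (a - r / 2) - e / 2 <= F a <= F (a - r / 2) + e / 2.
      by apply: ar; lra.
    lra.
  rewrite (Fneg _ ar1).
  have /andP[] : F 0 - e / 2 <= F a <= F 0 + e / 2 by apply: ar; lra.
  lra.
lra.
Qed.

Lemma wconv_sq_box (mn : nat -> {measure set (mR R * mR R)%type -> \bar R})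
    (m : {measure set (mR R * mR R)%type -> \bar R}) (a b : R) :
  (forall n, mn n setT = 1%E) -> (forall n, mn n unit_sq = 1%E) ->
  m setT = 1%E -> m unit_sq = 1%E ->
  cont_df (cdf1 m) -> cont_df (cdf2 m) -> wconv_sq mn m ->
  0 <= a <= 1 -> 0 <= b <= 1 ->
  fine (mn n (box a b)) @[n --> \oo] --> fine (m (box a b)).
Proof.
move=> mnT mn1 mT m1 c1 c2 cw a01 b01.
have cramp x y e : Rintegral (mn n) unit_sq (ramp2 x y e) @[n --> \oo] -->
    Rintegral m unit_sq (ramp2 x y e).
  have cr : {within unit_sq, continuous
      (ramp2 x y e : (R : topologicalType) * (R : topologicalType) -> R)}.
    by apply: continuous_subspaceT; exact: continuous_ramp2.
  have := cw _ cr; rewrite -[X in _ --> X]fineK; last first.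
    by apply: integrable_fin_num (integrable_ramp2 m1 x y e); exact: measurable_unit_sq.
  by move=> /fine_cvgP[].
apply/cvgrPdist_le => e e0.
have e4 : 0 < e / 4 by rewrite divr_gt0.
(* Each margin contributes e / 4, so the mass between the shifted boxes costs e / 2; the other e / 2
   is kept for the integrals of the ramps. *)
have [r1 r10 h1] : exists2 r, 0 < r & cdf1 m (a + r) - cdf1 m (a - r) <= e / 4.
  apply: cont_df_modulus => //.
  - by move=> x y xy; exact: fine_box_le.
  - exact: cdf1_lt0.
  - by move=> x x1; exact: fine_box_ge1.
have [r2 r20 h2] : exists2 r, 0 < r & cdf2 m (b + r) - cdf2 m (b - r) <= e / 4.
  apply: cont_df_modulus => //.
  - by move=> x y xy; exact: fine_box_le.
  - exact: cdf2_lt0.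
  - by move=> x x1; exact: fine_box_ge1.
pose r := Num.min r1 r2.
have r0 : 0 < r by rewrite lt_min r10.
have [rr1 rr2] : r <= r1 /\ r <= r2 by rewrite !ge_min !lexx orbT.
have H : fine (m (box (a + r) (b + r))) - fine (m (box (a - r) (b - r))) <= e / 2.
  have k1 : cdf1 m (a + r) <= cdf1 m (a + r1) by apply: fine_box_le => //; lra.
  have k2 : cdf1 m (a - r1) <= cdf1 m (a - r) by apply: fine_box_le => //; lra.
  have k3 : cdf2 m (b + r) <= cdf2 m (b + r2) by apply: fine_box_le => //; lra.
  have k4 : cdf2 m (b - r2) <= cdf2 m (b - r) by apply: fine_box_le => //; lra.
  have l1 : fine (m (box (a + r) (b + r))) - fine (m (box (a - r) (b + r))) <=
      cdf1 m (a + r) - cdf1 m (a - r) by apply: fine_box_subl => //; lra.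
  have l2 : fine (m (box (a - r) (b + r))) - fine (m (box (a - r) (b - r))) <=
      cdf2 m (b + r) - cdf2 m (b - r) by apply: fine_box_subr => //; lra.
  lra.
have e2 : 0 < e / 2 by rewrite divr_gt0.
(* The ramp descending from (a, b) bounds the box from above; the one that starts at (a - r, b - r)
   is back to zero at (a, b) and bounds it from below. *)
have /cvgrPdist_le/(_ _ e2) U := cramp a b r.
have /cvgrPdist_le/(_ _ e2) L := cramp (a - r) (b - r) r.
near=> n.
have Un : `|Rintegral m unit_sq (ramp2 a b r) - Rintegral (mn n) unit_sq (ramp2 a b r)|
  <= e / 2 by near: n; exact: U.
have Ln : `|Rintegral m unit_sq (ramp2 (a - r) (b - r) r) -
  Rintegral (mn n) unit_sq (ramp2 (a - r) (b - r) r)| <= e / 2 by near: n; exact: L.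
have /andP[u1 u2] := box_ramp_le mT m1 a b r0.
have /andP[u3 u4] := box_ramp_le mT m1 (a - r) (b - r) r0.
have /andP[v1 v2] := box_ramp_le (mnT n) (mn1 n) a b r0.
have /andP[v3 v4] := box_ramp_le (mnT n) (mn1 n) (a - r) (b - r) r0.
rewrite !subrK in u4 v4.
move: Un Ln; rewrite !ler_distl => /andP[w1 w2] /andP[w3 w4].
apply/andP; split; lra.
Unshelve. all: by end_near. Qed.

End box_convergence.

(** * Almost everywhere identities between kernels *)

Section kernel_densities.
Context {R : realType}.

Lemma ae_leb_mono (P Q : R -> Prop) : {ae leb R, forall t : R, P t} ->
  (forall t, P t -> Q t) -> {ae leb R, forall t : R, Q t}.
Proof.
move=> aP PQ; apply: filterS aP; first exact: (ae_filter_ringOfSetsType (leb R)).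
exact: PQ.
Qed.

Lemma ae_leb_and (P Q : R -> Prop) : {ae leb R, forall t : R, P t} ->
  {ae leb R, forall t : R, Q t} -> {ae leb R, forall t : R, P t /\ Q t}.
Proof.
move=> aP aQ; apply: filterI aP aQ; exact: (ae_filter_ringOfSetsType (leb R)).
Qed.

Lemma kernel_setT d (Y : measurableType d) (k : probability_kernel (mR R) Y R) t :
  k t setT = 1%E.
Proof. exact: prob_kernel. Qed.

Section one_kernel.
Context d (Y : measurableType d) (k : probability_kernel (mR R) Y R).
Variables (A : set Y) (mA : measurable A).

Lemma measurable_fine_kernel : measurable_fun [set: mR R] (fun t => fine (k t A)).
Proof. by apply: measurableT_comp => //; exact: measurable_kernel. Qed.

Lemma fine_kernel_bounds t : 0 <= fine (k t A) <= 1.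
Proof. by apply: (fine_probability_le1 measurableT); rewrite ?prob_kernel. Qed.

Lemma fine_kernel_norm t : `|fine (k t A)| <= 1.
Proof. by rewrite ger0_norm; have /andP[] := fine_kernel_bounds t. Qed.

Lemma integral_fine_kernel v :
  (\int[leb R]_(t in `[0%R, v]) k t A)%E =
  (Rintegral (leb R) `[0, v] (fun t => fine (k t A)))%:E.
Proof.
rewrite /Rintegral fineK; last first.
  apply: integrable_fin_num => //.
  exact: (bounded_integrable_itv 0 v measurable_fine_kernel fine_kernel_norm).
apply: eq_integral => t _; rewrite fineK//.
by apply: (probability_fin_num (kernel_setT k t)).
Qed.

Lemma ae_kernel_eq (g : R -> R) (M : R) :
  measurable_fun [set: mR R] g -> (forall t, `|g t| <= M) ->
  (forall v, 0 <= v <= 1 -> (\int[leb R]_(t in `[0%R, v]) k t A)%E =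
     (Rintegral (leb R) `[0, v] g)%:E) ->
  {ae leb R, forall t : R, 0 <= t <= 1 -> fine (k t A) = g t}.
Proof.
move=> mg gM kg.
apply: (ae_eq_of_integral measurable_fine_kernel fine_kernel_norm mg gM) => v v01.
by have := kg v v01; rewrite integral_fine_kernel => -[].
Qed.

End one_kernel.

(** The two kernels may live on different spaces: the same statement compares two versions on the
    square, and a kernel on the interval with a margin of one on the square. *)
Lemma ae_kernels_eq d d' (Y : measurableType d) (Y' : measurableType d')
    (k : probability_kernel (mR R) Y R) (k' : probability_kernel (mR R) Y' R)
    (A : set Y) (A' : set Y') : measurable A -> measurable A' ->
  (forall v, 0 <= v <= 1 -> (\int[leb R]_(t in `[0%R, v]) k t A)%E =
     (\int[leb R]_(t in `[0%R, v]) k' t A')%E) ->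
  {ae leb R, forall t : R, 0 <= t <= 1 -> fine (k t A) = fine (k' t A')}.
Proof.
move=> mA mA' kk'; apply: (ae_kernel_eq mA (measurable_fine_kernel k' mA')
  (fine_kernel_norm k' mA')) => v v01.
by rewrite kk'// integral_fine_kernel.
Qed.

Lemma ae_grid (P : nat -> nat -> nat -> nat -> R -> Prop) :
  (forall n N i j, (i <= N.+1)%N -> (j <= N.+1)%N ->
     {ae leb R, forall t : R, P n N i j t}) ->
  {ae leb R, forall t : R, forall n N i j, (i <= N.+1)%N -> (j <= N.+1)%N ->
     P n N i j t}.
Proof.
move=> H; apply: ae_foralln => n; apply: ae_foralln => N.
apply: ae_foralln => i; apply: ae_foralln => j.
have [iN|iN] := leqP i N.+1; last by apply: aeW.
have [jN|jN] := leqP j N.+1; last by apply: aeW.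
by apply: ae_leb_mono (H n N i j iN jN) _.
Qed.

Lemma grid01 N i : (i <= N.+1)%N -> 0 <= @grid R N i <= 1.
Proof. by move=> iN; rewrite grid_ge0 grid_le1. Qed.

(* Two versions agree almost everywhere on a grid, so the constant sequence K t converges
   weakly to K' t; its distribution functions then converge to those of K' t. *)
Lemma markov3_unique (C : R -> R -> R -> R) (K K' : kernel3 R) :
  is_markov3 C K -> is_markov3 C K' ->
  {ae leb R, forall t : R, 0 <= t <= 1 ->
    cont_df (F13 K' t) /\ cont_df (F23 K' t)} ->
  {ae leb R, forall t : R, 0 <= t <= 1 -> forall u1 u2, 0 <= u1 <= 1 -> 0 <= u2 <= 1 ->
     fine (K t (box u1 u2)) = fine (K' t (box u1 u2))}.
Proof.
move=> [KD KC] [K'D K'C] cK'.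
pose P (_ N i j : nat) t := 0 <= t <= 1 ->
  fine (K t (box (grid N i) (grid N j))) = fine (K' t (box (grid N i) (grid N j))).
have /ae_grid G n N i j : (i <= N.+1)%N -> (j <= N.+1)%N ->
    {ae leb R, forall t : R, P n N i j t}.
  move=> iN jN.
  apply: ae_kernels_eq; [exact: measurable_box|exact: measurable_box|] => v v01.
  by rewrite -KC ?grid01// -K'C ?grid01.
apply: ae_leb_mono (ae_leb_and G cK') _ => t [Gt cont] t01 u1 u2 u1I u2I.
have [c1 c2] := cont t01.
have W : wconv_sq (fun _ => K t) (K' t).
  apply: wconv_sq_grid => // N i j iN jN.
  by rewrite (Gt 0%N N i j iN jN t01); exact: cvg_cst.
have L := wconv_sq_box (mn := fun=> K t) (m := K' t) (fun=> kernel_setT K t)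
  (fun=> KD t) (kernel_setT K' t) (K'D t) c1 c2 W u1I u2I.
exact: cvg_unique (cvg_cst _) L.
Qed.

Lemma IVT_cont_df (F : R -> R) (s : R) : cont_df F -> F 1 = 1 -> 0 <= s <= 1 ->
  exists2 u, 0 <= u <= 1 & F u = s.
Proof.
move=> [cF F0] F1 s01.
have [|u uI Fu] := @IVT R F 0 1 s ler01 cF; last by exists u => //; move: uI; rewrite in_itv.
by rewrite F0 F1 minElt maxElt ltr01.
Qed.

Lemma cdf1_1 (K : kernel3 R) t : K t unit_sq = 1%E -> cdf1 (K t) 1 = 1.
Proof. by move=> KD; apply: (fine_box_ge1 (kernel_setT K t) KD). Qed.

Lemma cdf2_1 (K : kernel3 R) t : K t unit_sq = 1%E -> cdf2 (K t) 1 = 1.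
Proof. by move=> KD; apply: (fine_box_ge1 (kernel_setT K t) KD). Qed.

(** The hypothesis [wcc3] may be tested on any version of the limit kernel, in particular on [K0],
    whose margins are continuous. Box convergence and, by the intermediate value theorem,
    surjectivity of the margins are obtained for [K0] and carried to the given [K] by uniqueness
    almost everywhere. *)
Lemma wcc3_box (C : R -> R -> R -> R) (Cn : nat -> R -> R -> R -> R)
    (Kn : nat -> kernel3 R) (K : kernel3 R) :
  in_C3c C -> wcc3 Cn C -> (forall n, is_markov3 (Cn n) (Kn n)) -> is_markov3 C K ->
  {ae leb R, forall t : R, 0 <= t <= 1 ->
    [/\ forall u1 u2, 0 <= u1 <= 1 -> 0 <= u2 <= 1 ->
          fine (Kn n t (box u1 u2)) @[n --> \oo] --> fine (K t (box u1 u2)),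
        forall s, 0 <= s <= 1 -> exists2 u, 0 <= u <= 1 & F13 K t u = s &
        forall s, 0 <= s <= 1 -> exists2 u, 0 <= u <= 1 & F23 K t u = s]}.
Proof.
move=> [_ [K0 [mK0 cK0]]] cw mKn mK.
have := ae_leb_and (ae_leb_and (cw Kn K0 mKn mK0) cK0) (markov3_unique mK mK0 cK0).
move=> /ae_leb_mono; apply => t [[W cont] E] t01.
have [c1 c2] := cont t01; have {}E := E t01.
have I1 : 0 <= (1 : R) <= 1 by rewrite ler01 lexx.
split.
- move=> u1 u2 u1I u2I; rewrite E//.
  exact: (wconv_sq_box (mn := fun n => Kn n t) (m := K0 t)
    (fun n => kernel_setT (Kn n) t) (fun n => (mKn n).1 t) (kernel_setT K0 t) (mK0.1 t)
    c1 c2 (W t01) u1I u2I).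
- move=> s s01; have [u uI Fu] := IVT_cont_df c1 (cdf1_1 (mK0.1 t)) s01.
  by exists u => //; rewrite -Fu; exact: E.
- move=> s s01; have [u uI Fu] := IVT_cont_df c2 (cdf2_1 (mK0.1 t)) s01.
  by exists u => //; rewrite -Fu; exact: E.
Qed.

End kernel_densities.

(** * Lipschitz continuity of copulas and its consequences *)

Section copula_lipschitz.
Context {R : realType}.

Definition lipschitz_sq (A : R -> R -> R) : Prop :=
  forall x y x' y', 0 <= x <= 1 -> 0 <= y <= 1 -> 0 <= x' <= 1 -> 0 <= y' <= 1 ->
    `|A x y - A x' y'| <= `|x - x'| + `|y - y'|.

(** In the first variable, nonnegative mass of [x, x'] x [0, y] gives monotonicity, and that of
    [x, x'] x [y, 1] bounds the increment by x' - x. The second variable is symmetric, and the two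
    moves are added. *)
Lemma copula2_lipschitz (A : R -> R -> R) : copula2 A -> lipschitz_sq A.
Proof.
move=> [Ab Ainc].
have I0 : 0 <= (0 : R) <= 1 by rewrite lexx ler01.
have I1 : 0 <= (1 : R) <= 1 by rewrite lexx ler01.
have lip1 x x' y : 0 <= x -> x <= x' -> x' <= 1 -> 0 <= y <= 1 ->
    0 <= A x' y - A x y <= x' - x.
  move=> x0 xx' x1 /andP[y0 y1].
  have xI : 0 <= x <= 1 by rewrite x0 (le_trans xx').
  have x'I : 0 <= x' <= 1 by rewrite x1 (le_trans x0).
  have [e1 _ e2 _] := Ab _ xI; have [e3 _ e4 _] := Ab _ x'I.
  have := Ainc x x' 0 y x0 xx' x1 (lexx _) y0 y1.
  have := Ainc x x' y 1 x0 xx' x1 y0 y1 (lexx _).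
  by rewrite e1 e2 e3 e4 => ? ?; apply/andP; split; lra.
have lip2 x y y' : 0 <= y -> y <= y' -> y' <= 1 -> 0 <= x <= 1 ->
    0 <= A x y' - A x y <= y' - y.
  move=> y0 yy' y1 /andP[x0 x1].
  have yI : 0 <= y <= 1 by rewrite y0 (le_trans yy').
  have y'I : 0 <= y' <= 1 by rewrite y1 (le_trans y0).
  have [_ e1 _ e2] := Ab _ yI; have [_ e3 _ e4] := Ab _ y'I.
  have := Ainc 0 x y y' (lexx _) x0 x1 y0 yy' y1.
  have := Ainc x 1 y y' x0 x1 (lexx _) y0 yy' y1.
  by rewrite e1 e2 e3 e4 => ? ?; apply/andP; split; lra.
have abs1 x x' y : 0 <= x <= 1 -> 0 <= x' <= 1 -> 0 <= y <= 1 ->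
    `|A x y - A x' y| <= `|x - x'|.
  move=> /andP[x0 x1] /andP[x'0 x'1] yI.
  have [xx'|/ltW xx'] := leP x x'.
    have /andP[h1 h2] := lip1 x x' y x0 xx' x'1 yI.
    by rewrite distrC (distrC x) ger0_norm// ger0_norm ?subr_ge0.
  have /andP[h1 h2] := lip1 x' x y x'0 xx' x1 yI.
  by rewrite ger0_norm// ger0_norm ?subr_ge0.
have abs2 x y y' : 0 <= y <= 1 -> 0 <= y' <= 1 -> 0 <= x <= 1 ->
    `|A x y - A x y'| <= `|y - y'|.
  move=> /andP[y0 y1] /andP[y'0 y'1] xI.
  have [yy'|/ltW yy'] := leP y y'.
    have /andP[h1 h2] := lip2 x y y' y0 yy' y'1 xI.
    by rewrite distrC (distrC y) ger0_norm// ger0_norm ?subr_ge0.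
  have /andP[h1 h2] := lip2 x y' y y'0 yy' y1 xI.
  by rewrite ger0_norm// ger0_norm ?subr_ge0.
move=> x y x' y' xI yI x'I y'I.
rewrite -(subrKA (A x' y)) (le_trans (ler_normD _ _))// lerD//.
  exact: abs1.
exact: abs2.
Qed.

Lemma copula2_norm_le1 (A : R -> R -> R) x y : copula2 A ->
  0 <= x <= 1 -> 0 <= y <= 1 -> `|A x y| <= 1.
Proof.
move=> cA xI yI; have I0 : 0 <= (0 : R) <= 1 by rewrite lexx ler01.
have [_ A0 _ _] := cA.1 _ yI.
have := copula2_lipschitz cA xI yI I0 yI.
rewrite A0 subrr normr0 addr0 !subr0 => /le_trans; apply.
by case/andP: xI => x0 x1; rewrite ger0_norm.
Qed.

Lemma lipschitz_sq_continuous (A : R -> R -> R) : lipschitz_sq A ->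
  {within unit_sq, continuous
    ((fun p => A p.1 p.2) : (R : topologicalType) * (R : topologicalType) -> R)}.
Proof.
move=> lA; apply/subspace_continuousP => -[x y] xyD.
have [/unit_intP xI /unit_intP yI] : unit_int x /\ unit_int y by [].
apply/cvgrPdist_le => e e0.
have e2 : 0 < e / 2 by rewrite divr_gt0.
apply/nbhs_ballP; exists (e / 2) => // -[x' y'] [/= xx' yy'] x'y'D.
have [/unit_intP x'I /unit_intP y'I] : unit_int x' /\ unit_int y' by [].
by rewrite /= (le_trans (lA _ _ _ _ xI yI x'I y'I))// [leRHS]splitr lerD// ltW.
Qed.

(** The values of [A] off the square are arbitrary, so [A] cannot be treated as a Borel function on
    the plane. Since [X] and [Y] stay in the unit interval, step functions of them approximate the
    composition uniformly. *)
Lemma measurable_lipschitz_comp d (T : measurableType d) (A : R -> R -> R)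
    (X Y : T -> R) : lipschitz_sq A ->
  measurable_fun setT X -> measurable_fun setT Y ->
  (forall t, 0 <= X t <= 1) -> (forall t, 0 <= Y t <= 1) ->
  measurable_fun setT (fun t => A (X t) (Y t)).
Proof.
move=> lA mX mY XI YI; apply: measurable_fun_unif => e e0.
have [N AN] := step_fun2_approx (lipschitz_sq_continuous lA) e0.
exists (fun t => step_fun2 N (fun p => A p.1 p.2) (X t, Y t)); last first.
  have XY t : unit_sq (X t, Y t) by split; apply/unit_intP; [exact: XI|exact: YI].
  by move=> t _; exact: (AN _ (XY t)).
have mw i (Z : T -> R) : measurable_fun setT Z ->
    measurable_fun setT (fun t => grid_wgt N i (Z t)).
  move=> mZ; apply: (measurableT_comp (f := grid_wgt N i)) => //.
  by apply: (@measurable_funB _ (mR R) _ _ \1_(grid_itv N i.+1) \1_(grid_itv N i));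
    apply: measurable_indic; exact: measurable_grid_itv.
rewrite /step_fun2.
apply: measurable_sum => i; apply: measurable_sum => j.
apply: measurable_funM; first exact: measurable_cst.
by apply: measurable_funM; exact: mw.
Qed.

(** The Lipschitz constant is the same for all n, so pointwise convergence survives arguments that
    move with n. *)
Lemma lipschitz_sq_cvg (An : nat -> R -> R -> R) (A : R -> R -> R)
    (xn yn : nat -> R) (x y : R) : (forall n, lipschitz_sq (An n)) ->
  (forall s1 s2, 0 <= s1 <= 1 -> 0 <= s2 <= 1 -> An n s1 s2 @[n --> \oo] --> A s1 s2) ->
  (forall n, 0 <= xn n <= 1) -> (forall n, 0 <= yn n <= 1) ->
  0 <= x <= 1 -> 0 <= y <= 1 ->
  xn n @[n --> \oo] --> x -> yn n @[n --> \oo] --> y ->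
  An n (xn n) (yn n) @[n --> \oo] --> A x y.
Proof.
move=> lA cA xnI ynI xI yI cx cy.
have := cA x y xI yI => /cvgrPdist_le c1.
move/cvgrPdist_le : cx => cx; move/cvgrPdist_le : cy => cy.
apply/cvgrPdist_le => e e0; have e3 : 0 < e / 3 by rewrite divr_gt0.
near=> n.
have h1 : `|A x y - An n x y| <= e / 3 by near: n; exact: c1.
have h2 : `|x - xn n| <= e / 3 by near: n; exact: cx.
have h3 : `|y - yn n| <= e / 3 by near: n; exact: cy.
have h4 := lA n x y (xn n) (yn n) xI yI (xnI n) (ynI n).
rewrite -(subrKA (An n x y)) (le_trans (ler_normD _ _))//.
rewrite (le_trans (lerD h1 h4))//; lra.
Unshelve. all: by end_near. Qed.

(** The cell weights at x sum to 1, so one of them is nonzero. *)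
Lemma exists_grid_near N (x : R) : 0 <= x <= 1 ->
  exists i : 'I_N.+1, `|grid N i.+1 - x| <= N.+1%:R^-1.
Proof.
move=> xI; have [/existsP[i wi]|/existsPn w0] :=
  boolP [exists i : 'I_N.+1, grid_wgt N i x != 0].
  by exists i; exact: grid_wgt_neq0.
have := sum_grid_wgt N xI; rewrite big1 => [/esym/eqP|i _].
  by rewrite oner_eq0.
by have := w0 i; rewrite negbK => /eqP.
Qed.

Lemma lipschitz_sq_unif_cvg (An : nat -> R -> R -> R) (A : R -> R -> R) :
  (forall n, lipschitz_sq (An n)) -> lipschitz_sq A ->
  (forall s1 s2, 0 <= s1 <= 1 -> 0 <= s2 <= 1 -> An n s1 s2 @[n --> \oo] --> A s1 s2) ->
  dinf (An n) A @[n --> \oo] --> 0%E.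
Proof.
move=> lAn lA cA.
have U e : 0 < e -> \forall n \near \oo, (0%E <= dinf (An n) A <= e%:E)%E.
  (* Moving both coordinates to a grid point costs 2e / 5 for [A] and 2e / 5 for [An n]; the last
     fifth is the difference at the grid point. *)
  move=> e0; have e5 : 0 < e / 5 by rewrite divr_gt0.
  have [N Ne] := invS_lt e5.
  have : \forall n \near \oo, forall ij : 'I_N.+1 * 'I_N.+1,
      `|A (grid N ij.1.+1) (grid N ij.2.+1) - An n (grid N ij.1.+1) (grid N ij.2.+1)|
        <= e / 5.
    apply: filter_forall => -[i j] /=.
    by have /cvgrPdist_le := cA _ _ (grid_in01 i) (grid_in01 j); apply.
  apply: filterS => n H; apply/andP; split.
    (* A supremum in the extended reals is nonnegative only once some point is exhibited; the origin
       serves. *)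
    apply: (@le_trans _ _ (`|An n 0 0 - A 0 0|)%:E); first by rewrite lee_fin.
    apply: ereal_sup_ubound; exists (0, 0) => //.
    by split; apply/unit_intP; rewrite lexx ler01.
  apply: ge_ereal_sup => _ [[x y] xyD <-]; rewrite lee_fin /=.
  have [/unit_intP xI /unit_intP yI] : unit_int x /\ unit_int y by [].
  have [i hi] := exists_grid_near N xI; have [j hj] := exists_grid_near N yI.
  have l1 := lA _ _ _ _ (grid_in01 i) (grid_in01 j) xI yI.
  have l2 := lAn n _ _ _ _ (grid_in01 i) (grid_in01 j) xI yI.
  have l3 : `|A (grid N i.+1) (grid N j.+1) - An n (grid N i.+1) (grid N j.+1)| <= e / 5.
    exact: H (i, j).
  have {hi}hi := le_lt_trans hi Ne; have {hj}hj := le_lt_trans hj Ne.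
  have {hi hj}hij := ltrD hi hj.
  have {}l1 := le_lt_trans l1 hij; have {}l2 := le_lt_trans l2 hij.
  move: l1 l2 l3; rewrite !(ltr_norml, ler_norml).
  move=> /andP[? ?] /andP[? ?] /andP[? ?].
  by apply/andP; split; lra.
apply/fine_cvgP; split.
  apply: filterS (U 1 ltr01) => n /andP[d0 d1].
  by rewrite ge0_fin_numE// (le_lt_trans d1)// ltry.
apply/cvgrPdist_le => e e0; apply: filterS (U e e0) => n /andP[d0 d1] /=.
have fd : dinf (An n) A \is a fin_num by rewrite ge0_fin_numE// (le_lt_trans d1)// ltry.
rewrite sub0r normrN ger0_norm ?fine_ge0//.
by rewrite -lee_fin fineK.
Qed.

End copula_lipschitz.

(** * Partial copulas and the kernel of the partial vine copula *)

Section partial_copulas.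
Context {R : realType}.

(** The bound is asked only almost everywhere because [CC t] is known to be a copula only for almost
    every t. As the unit interval has measure 1, the integral inherits the same [M]. *)
Lemma integrable_ae_bounded (h : R -> R) (M : R) : 0 <= M ->
  measurable_fun [set: mR R] h ->
  {ae leb R, forall t : R, 0 <= t <= 1 -> `|h t| <= M} ->
  (leb R).-integrable `[0, 1] (EFin \o h) /\ `|Rintegral (leb R) `[0, 1] h| <= M.
Proof.
move=> M0 mh hM.
have mh1 : measurable_fun (`[0, 1]%classic : set (mR R)) (EFin \o h).
  by apply/measurable_EFinP; exact: measurable_funTS.
have leb01 : leb R `[0, 1]%classic = 1%E.
  by rewrite lebesgue_measure_itv/= lte_fin ltr01 oppr0 adde0.
have B : (\int[leb R]_(t in `[0%R, 1%R]) `|(h t)%:E| <= M%:E)%E.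
  by rewrite -[leRHS]mule1 -leb01; apply: integral_le_bound.
have ih : (leb R).-integrable `[0, 1] (EFin \o h).
  by apply/integrableP; split => //; rewrite (le_lt_trans B)// ltry.
split => //; rewrite (le_trans (le_normr_Rintegral _ ih))//.
rewrite -lee_fin (le_trans _ B)// /Rintegral fineK//.
by apply: integrable_fin_num => //; exact: integrable_norm.
Qed.

Variables (K : kernel3 R) (CC : R -> R -> R -> R).
Hypothesis KCC : cond_copula_family K CC.

Lemma ae_copula2 : {ae leb R, forall t : R, 0 <= t <= 1 -> copula2 (CC t)}.
Proof. by apply: ae_leb_mono KCC.2 _ => t h /h[]. Qed.

Lemma integrable_copula s1 s2 : 0 <= s1 <= 1 -> 0 <= s2 <= 1 ->
  (leb R).-integrable `[0, 1] (EFin \o (fun t => CC t s1 s2)) /\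
  `|partial_copula CC s1 s2| <= 1.
Proof.
move=> s1I s2I; apply: integrable_ae_bounded => //; first exact: KCC.1.
by apply: ae_leb_mono ae_copula2 _ => t h /h cC; exact: copula2_norm_le1.
Qed.

(** Averaging over t, of total mass 1, preserves the Lipschitz constant shared by almost all
    [CC t]. *)
Lemma partial_copula_lipschitz : lipschitz_sq (partial_copula CC).
Proof.
move=> x y x' y' xI yI x'I y'I; rewrite /partial_copula -RintegralB//.
- apply: (integrable_ae_bounded _ _ _).2.
  + by rewrite addr_ge0.
  + by apply: measurable_funB; exact: KCC.1.
  + by apply: ae_leb_mono ae_copula2 _ => t h /h /copula2_lipschitz; exact.
- exact: (integrable_copula xI yI).1.
- exact: (integrable_copula x'I y'I).1.
Qed.

(** The integrand of [psi], hence the value that every Markov kernel of [psi K CC] must take on a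
    box for almost every t. *)
Definition psi_density (u1 u2 t : R) : R :=
  partial_copula CC (F13 K t u1) (F23 K t u2).

Lemma F13_bounds t u : 0 <= F13 K t u <= 1.
Proof. by apply: fine_kernel_bounds; exact: measurable_box. Qed.

Lemma F23_bounds t u : 0 <= F23 K t u <= 1.
Proof. by apply: fine_kernel_bounds; exact: measurable_box. Qed.

Lemma measurable_psi_density u1 u2 :
  measurable_fun [set: mR R] (psi_density u1 u2).
Proof.
apply: (measurable_lipschitz_comp (A := partial_copula CC)
  (X := fun t => F13 K t u1) (Y := fun t => F23 K t u2)).
- exact: partial_copula_lipschitz.
- by apply: measurable_fine_kernel; exact: measurable_box.
- by apply: measurable_fine_kernel; exact: measurable_box.
- by move=> t; exact: F13_bounds.
- by move=> t; exact: F23_bounds.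
Qed.

Lemma psi_density_norm u1 u2 t : `|psi_density u1 u2 t| <= 1.
Proof. exact: (integrable_copula (F13_bounds t u1) (F23_bounds t u2)).2. Qed.

Lemma ae_psi_kernel (L : kernel3 R) u1 u2 : is_markov3 (psi K CC) L ->
  0 <= u1 <= 1 -> 0 <= u2 <= 1 ->
  {ae leb R, forall t : R, 0 <= t <= 1 -> fine (L t (box u1 u2)) = psi_density u1 u2 t}.
Proof.
move=> [_ mL] u1I u2I; apply: (ae_kernel_eq (measurable_box _ _)
  (measurable_psi_density u1 u2) (psi_density_norm u1 u2)) => v v01.
by rewrite -mL.
Qed.

End partial_copulas.

(** * The three convergence statements *)

Section convergence.
Context {R : realType}.
Variables (C : R -> R -> R -> R) (Cn : nat -> R -> R -> R -> R).
Hypotheses (cC : in_C3c C) (cw : wcc3 Cn C).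

Let I1 : 0 <= (1 : R) <= 1.
Proof. by rewrite ler01 lexx. Qed.

Let cCn_kernels (cCn : forall n, in_C3c (Cn n)) :
  exists Kn : nat -> kernel3 R, forall n, is_markov3 (Cn n) (Kn n).
Proof.
have /choice[Kn mKn] n : exists K : kernel3 R, is_markov3 (Cn n) K.
  by have [_ [K [mK _]]] := cCn n; exists K.
by exists Kn.
Qed.

(* [S u] is the point (u, 1) for the margin C13 and (1, u) for C23. *)
Lemma wcc2_margin (S : R -> R * R) (M : (R -> R -> R -> R) -> R -> R -> R) :
  (forall n, in_C3c (Cn n)) ->
  (forall u, 0 <= u <= 1 -> 0 <= (S u).1 <= 1 /\ 0 <= (S u).2 <= 1) ->
  (forall D u v, M D u v = D (S u).1 (S u).2 v) ->
  wcc2 (fun n => M (Cn n)) (M C).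
Proof.
move=> cCn SI MS An A mAn mA.
(* [wcc2] supplies only kernels of the margins; the kernels on the square to which [wcc3] applies
   come from membership in the class. *)
have [Kn mKn] := cCn_kernels cCn.
have [_ [K [mK _]]] := cC.
have margin D (k : kernel3 R) (k' : kernel2 R) u : is_markov3 D k -> is_markov2 (M D) k' ->
    0 <= u <= 1 -> {ae leb R, forall t : R, 0 <= t <= 1 ->
      fine (k' t `[0, u]%classic) = fine (k t (box (S u).1 (S u).2))}.
  move=> [_ kD] [_ k'D] uI; apply: ae_kernels_eq => //; first exact: measurable_box.
  by move=> v v01; have [S1 S2] := SI u uI; rewrite -k'D// MS kD.
(* An interval has one grid index, so the second slot is a dummy, filled with 0 below; the identity
   for the limit is likewise read off at n = 0. *)
pose P (n N i _ : nat) t := 0 <= t <= 1 ->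
  fine (An n t `[0, grid N i]%classic) =
  fine (Kn n t (box (S (grid N i)).1 (S (grid N i)).2)) /\
  fine (A t `[0, grid N i]%classic) =
  fine (K t (box (S (grid N i)).1 (S (grid N i)).2)).
have /ae_grid G n N i j : (i <= N.+1)%N -> (j <= N.+1)%N ->
    {ae leb R, forall t : R, P n N i j t}.
  move=> iN _.
  have := ae_leb_and (margin _ _ _ _ (mKn n) (mAn n) (grid01 iN))
    (margin _ _ _ _ mK mA (grid01 iN)).
  by move=> /ae_leb_mono; apply => t [h1 h2] t01; split; [exact: h1|exact: h2].
have := ae_leb_and G (wcc3_box cC cw mKn mK).
move=> /ae_leb_mono; apply => t [Gt bt] t01.
have [bc _ _] := bt t01.
apply: wconv_int_grid => [n||N i iN].
- exact: (mAn n).1.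
- exact: mA.1.
- have [_ ->] := Gt 0%N N i 0%N iN (leq0n _) t01.
  under eq_fun do rewrite (Gt _ N i 0%N iN (leq0n _) t01).1.
  by have [S1 S2] := SI _ (grid01 iN); exact: bc.
Qed.

Variables (Kn : nat -> kernel3 R) (K : kernel3 R).
Variables (CCn : nat -> R -> R -> R -> R) (CC : R -> R -> R -> R).
Hypotheses (mKn : forall n, is_markov3 (Cn n) (Kn n)) (mK : is_markov3 C K).
Hypotheses (KCCn : forall n, cond_copula_family (Kn n) (CCn n))
  (KCC : cond_copula_family K CC).

(* Continuity of the limiting marginals gives u with s = (F13 u1, F23 u2); the copulas
   CCn n t are 1-Lipschitz, so they may be evaluated at the n-th marginals instead of s. *)
Lemma ae_cond_copula_cvg :
  {ae leb R, forall t : R, 0 <= t <= 1 -> forall s1 s2, 0 <= s1 <= 1 -> 0 <= s2 <= 1 ->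
    CCn n t s1 s2 @[n --> \oo] --> CC t s1 s2}.
Proof.
have An := ae_foralln (fun n => (KCCn n).2).
have := ae_leb_and (ae_leb_and An KCC.2) (wcc3_box cC cw mKn mK).
move=> /ae_leb_mono; apply => t [[ht h] bt] t01 s1 s2 s1I s2I.
have {}ht n := ht n t01; have {h}[cCt Kt] := h t01.
have [bc f1 f2] := bt t01.
have [u1 u1I Fu1] := f1 _ s1I; have [u2 u2I Fu2] := f2 _ s2I.
have B := bc u1 u2 u1I u2I.
have c1 : F13 (Kn n) t u1 @[n --> \oo] --> s1.
  by rewrite -Fu1; exact: (bc u1 1 u1I I1).
have c2 : F23 (Kn n) t u2 @[n --> \oo] --> s2.
  by rewrite -Fu2; exact: (bc 1 u2 I1 u2I).
have E n : fine (Kn n t (box u1 u2)) = CCn n t (F13 (Kn n) t u1) (F23 (Kn n) t u2).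
  by rewrite /box (ht n).2.
have {}B : CCn n t (F13 (Kn n) t u1) (F23 (Kn n) t u2) @[n --> \oo] --> CC t s1 s2.
  by move: B; rewrite /box Kt// Fu1 Fu2 /=; under eq_fun do rewrite -/(box u1 u2) E.
apply/cvgrPdist_le => e e0; have e3 : 0 < e / 3 by rewrite divr_gt0.
move/cvgrPdist_le : c1 => /(_ _ e3) c1; move/cvgrPdist_le : c2 => /(_ _ e3) c2.
move/cvgrPdist_le : B => /(_ _ e3) B.
near=> n.
have h1 : `|s1 - F13 (Kn n) t u1| <= e / 3 by near: n.
have h2 : `|s2 - F23 (Kn n) t u2| <= e / 3 by near: n.
have h3 : `|CC t s1 s2 - CCn n t (F13 (Kn n) t u1) (F23 (Kn n) t u2)| <= e / 3.
  by near: n.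
have := copula2_lipschitz (ht n).1 s1I s2I (F13_bounds (Kn n) t u1) (F23_bounds (Kn n) t u2).
rewrite distrC => h4.
rewrite -(subrKA (CCn n t (F13 (Kn n) t u1) (F23 (Kn n) t u2))).
rewrite (le_trans (ler_normD _ _))// (le_trans (lerD h3 h4))//; lra.
Unshelve. all: by end_near. Qed.

Lemma partial_copula_cvg s1 s2 : 0 <= s1 <= 1 -> 0 <= s2 <= 1 ->
  partial_copula (CCn n) s1 s2 @[n --> \oo] --> partial_copula CC s1 s2.
Proof.
move=> s1I s2I.
have iC := (integrable_copula KCC s1I s2I).1.
(* The constant 1 dominates, since almost all the functions [CCn n t] are copulas, for all n at
   once. *)
have [] := @dominated_convergence _ (mR R) R (leb R) `[0, 1]%classic (measurable_itv _)
  (fun n t => (CCn n t s1 s2)%:E) (fun t => (CC t s1 s2)%:E) (cst 1%E).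
- by move=> n; apply/measurable_EFinP; apply: measurable_funTS; exact: (KCCn n).1.
- by apply/measurable_EFinP; apply: measurable_funTS; exact: KCC.1.
- apply: ae_leb_mono ae_cond_copula_cvg _ => t h tI.
  have t01 : 0 <= t <= 1 by move: tI; rewrite /= in_itv.
  by apply: cvg_EFin; [exact: nearW|exact: h].
- apply: (bounded_integrable_itv (M := 1) (f := cst 1)) => //.
  by move=> x; rewrite normr1.
- have := ae_foralln (fun n => ae_copula2 (KCCn n)).
  move=> /ae_leb_mono; apply => t h n tI; rewrite lee_fin.
  have t01 : 0 <= t <= 1 by move: tI; rewrite /= in_itv.
  exact: copula2_norm_le1 (h n t01) s1I s2I.
have fC : (\int[leb R]_(t in `[0%R, 1%R]) (CC t s1 s2)%:E)%E \is a fin_num.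
  exact: integrable_fin_num iC.
move=> _ _; rewrite -(fineK fC).
by move=> /fine_cvgP[].
Qed.

Lemma dinf_partial_copula_cvg :
  dinf (partial_copula (CCn n)) (partial_copula CC) @[n --> \oo] --> 0%E.
Proof.
apply: lipschitz_sq_unif_cvg => [n||s1 s2].
- exact: partial_copula_lipschitz (KCCn n).
- exact: partial_copula_lipschitz KCC.
- exact: partial_copula_cvg.
Qed.

(** For almost every t, a kernel of psi(C_n) on a grid box is (C_n)_p evaluated at the conditional
    margins of C_n. Function and arguments both depend on n; the common Lipschitz constant of the
    (C_n)_p combines their separate limits. *)
Lemma wcc3_psi : wcc3 (fun n => psi (Kn n) (CCn n)) (psi K CC).
Proof.
move=> Ln L mLn mL.
pose P (n N i j : nat) t := 0 <= t <= 1 ->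
  fine (Ln n t (box (grid N i) (grid N j))) =
    psi_density (Kn n) (CCn n) (grid N i) (grid N j) t /\
  fine (L t (box (grid N i) (grid N j))) = psi_density K CC (grid N i) (grid N j) t.
have /ae_grid G n N i j : (i <= N.+1)%N -> (j <= N.+1)%N ->
    {ae leb R, forall t : R, P n N i j t}.
  move=> iN jN.
  have := ae_leb_and (ae_psi_kernel (KCCn n) (mLn n) (grid01 iN) (grid01 jN))
    (ae_psi_kernel KCC mL (grid01 iN) (grid01 jN)).
  by move=> /ae_leb_mono; apply => t [h1 h2] t01; split; [exact: h1|exact: h2].
have := ae_leb_and G (wcc3_box cC cw mKn mK).
move=> /ae_leb_mono; apply => t [Gt bt] t01.
have [bc _ _] := bt t01.
apply: wconv_sq_grid => [n||N i j iN jN].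
- exact: (mLn n).1.
- exact: mL.1.
- have [_ ->] := Gt 0%N N i j iN jN t01.
  under eq_fun do rewrite (Gt _ N i j iN jN t01).1.
  apply: (lipschitz_sq_cvg (An := fun n => partial_copula (CCn n))
    (A := partial_copula CC) (xn := fun n => F13 (Kn n) t (grid N i))
    (yn := fun n => F23 (Kn n) t (grid N j))) => [n||n|n||||].
  + exact: partial_copula_lipschitz (KCCn n).
  + exact: partial_copula_cvg.
  + exact: F13_bounds.
  + exact: F23_bounds.
  + exact: F13_bounds.
  + exact: F23_bounds.
  + exact: (bc _ 1 (grid01 iN) I1).
  + exact: (bc 1 _ I1 (grid01 jN)).
Qed.

End convergence.

Unset Implicit Arguments.
Set Strict Implicit.

Theorem theorem6p3 (R : realType) (C : R -> R -> R -> R)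
  (Cn : nat -> R -> R -> R -> R) :
  in_C3c C -> (forall n, in_C3c (Cn n)) ->
  (* (1) *)
  (wcc3 Cn C ->
     wcc2 (fun n => C13 (Cn n)) (C13 C) /\
     wcc2 (fun n => C23 (Cn n)) (C23 C)) /\
  (* (2) *)
  (wcc3 Cn C ->
     forall (Kn : nat -> kernel3 R) (K : kernel3 R)
            (CCn : nat -> R -> R -> R -> R) (CC : R -> R -> R -> R),
       (forall n, is_markov3 (Cn n) (Kn n)) -> is_markov3 C K ->
       (forall n, cond_copula_family (Kn n) (CCn n)) ->
       cond_copula_family K CC ->
       dinf (partial_copula (CCn n)) (partial_copula CC) @[n --> \oo]
         --> 0%E) /\
  (* (3) *)
  (wcc3 Cn C ->
     forall (Kn : nat -> kernel3 R) (K : kernel3 R)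
            (CCn : nat -> R -> R -> R -> R) (CC : R -> R -> R -> R),
       (forall n, is_markov3 (Cn n) (Kn n)) -> is_markov3 C K ->
       (forall n, cond_copula_family (Kn n) (CCn n)) ->
       cond_copula_family K CC ->
       wcc3 (fun n => psi (Kn n) (CCn n)) (psi K CC)).
Proof.
move=> cC cCn; have I1 : 0 <= (1 : R) <= 1 by rewrite ler01 lexx.
split; first (move=> cw; split).
- exact: (wcc2_margin cC cw (S := fun u => (u, 1)) (M := C13)).
- exact: (wcc2_margin cC cw (S := fun u => (1, u)) (M := C23)).
split=> cw Kn K CCn CC mKn mK KCCn KCC.
- exact: (dinf_partial_copula_cvg cC cw mKn mK KCCn KCC).
- exact: (wcc3_psi cC cw mKn mK KCCn KCC).
Qed.
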